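(* Let $\rho\in(\sqrt3/2,1)$ be a real number, and let $B\in\mathbb{R}^{n\times n}$ be the matrix with columns $$b_1=(1,0,\dots,0)^T,\qquad b_i=\left(\tfrac{\rho^0}{2},\tfrac{\rho^1}{2},\dots,\tfrac{\rho^{i-2}}{2},\rho^{i-1},0,\dots,0\right)^T\quad(i=2,\dots,n).$$ Let $e$ be the all-ones vector in $\mathbb{R}^n$ and $Q=\{\lambda\in\mathbb{R}^n : 0\le B\lambda\le e\}$. The following hold: 1. The columns of $B$ are an LLL-reduced basis of the lattice that they generate. 2. $b_n$ is the longest among the $b_i$. 3. $\operatorname{width}(e_n,Q)>c^n\|b_n\|$ for some $c>1$, where $e_n$ is the $n$th unit vector.
   Context: $\|\cdot\|$ is the Euclidean norm. $\operatorname{width}(c,Q)=\max\{c\lambda : \lambda\in Q\}-\min\{c\lambda : \lambda\in Q\}$. LLL-reduced: for linearly independent $b_1,\dots,b_n$ with Gram–Schmidt orthogonalization $b_1^*,\dots,b_n^*$, write $b_i=\sum_{j=1}^i\mu_{ij}b_j^*$ with $\mu_{ii}=1$ and $\mu_{ij}=b_i^Tb_j^*/\|b_j^*\|^2$ for $j<i$. The basis is LLL-reduced if $|\mu_{ij}|\le\frac12$ for $1\le j<i\le n$ and $\|\mu_{i,i-1}b_{i-1}^*+b_i^*\|^2\ge\frac34\|b_{i-1}^*\|^2$ for $2\le i\le n$.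
   Formalization: Item 3 is stated for all sufficiently large n, with c > 1 and the threshold depending only on ρ; as written it fails for n = 1 (the width and the norm of b_1 both equal 1) and for n = 2 with ρ near 1. *)

(* Defs.v *)
From mathcomp Require Import all_boot all_order all_algebra.
From mathcomp Require Import classical_sets reals.

Set Implicit Arguments.
Unset Strict Implicit.
Unset Printing Implicit Defensive.

Import Order.TTheory GRing.Theory Num.Theory.
Local Open Scope ring_scope.
Local Open Scope classical_set_scope.

(* All indices are 0-based: the ordinal i stands for the index i + 1 of the
   usual numbering of basis vectors and coordinates. *)

Section Lattices.
Context {R : realType}.

Definition dot {m : nat} (u v : 'cV[R]_m) : R := (u^T *m v) 0 0.

(* The norm that MathComp-Analysis puts on matrices is the sup norm, hence a
   separate Euclidean norm. *)
Definition enorm {m : nat} (v : 'cV[R]_m) : R :=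
  Num.sqrt (\sum_i (v i 0) ^+ 2).

Definition gs_coef {m : nat} (v u : 'cV[R]_m) : R := dot v u / enorm u ^+ 2.

(* Gram-Schmidt orthogonalization (without normalization) of a list of
   vectors; see gsoE for the usual recursion. *)
Definition gso_seq {m : nat} (s : seq 'cV[R]_m) : seq 'cV[R]_m :=
  foldl (fun t v => rcons t (v - \sum_(u <- t) gs_coef v u *: u)) [::] s.

Definition gso {m n : nat} (B : 'M[R]_(m, n)) (i : 'I_n) : 'cV[R]_m :=
  nth 0 (gso_seq [seq col k B | k <- enum 'I_n]) i.

Definition mu {m n : nat} (B : 'M[R]_(m, n)) (i j : 'I_n) : R :=
  gs_coef (col i B) (gso B j).

Lemma size_gso_seq m (s : seq 'cV[R]_m) : size (gso_seq s) = size s.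
Proof.
elim/last_ind: s => // s v IHs.
by rewrite /gso_seq foldl_rcons !size_rcons -/(gso_seq s) IHs.
Qed.

Lemma nth_gso_seq m (s : seq 'cV[R]_m) (i : nat) : (i < size s)%N ->
  nth 0 (gso_seq s) i =
  nth 0 s i - \sum_(j < i) gs_coef (nth 0 s i) (nth 0 (gso_seq s) j)
                             *: nth 0 (gso_seq s) j.
Proof.
elim/last_ind: s => // s v IHs; rewrite size_rcons ltnS => le_is.
rewrite {1 2 3}/gso_seq foldl_rcons -/(gso_seq s) !nth_rcons !size_gso_seq.
have Dsum (w : 'cV[R]_m) :
    \sum_(j < i) gs_coef w (nth 0 (rcons (gso_seq s)
       (v - \sum_(u <- gso_seq s) gs_coef v u *: u)) j) *:
       nth 0 (rcons (gso_seq s)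
       (v - \sum_(u <- gso_seq s) gs_coef v u *: u)) j
    = \sum_(j < i) gs_coef w (nth 0 (gso_seq s) j) *: nth 0 (gso_seq s) j.
  apply: eq_bigr => j _; rewrite nth_rcons size_gso_seq.
  by rewrite (leq_trans (ltn_ord j) le_is).
rewrite Dsum; case: ltngtP le_is => // [lt_is | ->] _; first exact: IHs.
by rewrite (big_nth 0) size_gso_seq big_mkord.
Qed.

Lemma gsoE m n (B : 'M[R]_(m, n)) (i : 'I_n) :
  gso B i = col i B - \sum_(j < n | (j < i)%N) mu B i j *: gso B j.
Proof.
have lt_i : (i < size (enum 'I_n))%N by rewrite size_enum_ord.
rewrite /mu /gso nth_gso_seq; last by rewrite size_map.
rewrite (nth_map i) // nth_ord_enum.
congr (_ - _); pose s := gso_seq [seq col k B | k <- enum 'I_n].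
exact: (big_ord_widen n
  (fun j => gs_coef (col i B) (nth 0 s j) *: nth 0 s j) (ltnW (ltn_ord i))).
Qed.

Definition lattice {m n : nat} (B : 'M[R]_(m, n)) : set 'cV[R]_m :=
  [set v | exists z : 'cV[int]_n, v = B *m map_mx intr z].

Definition lattice_basis {m n : nat} (B : 'M[R]_(m, n)) (L : set 'cV[R]_m) :
    Prop :=
  row_free B^T /\ lattice B = L.

Definition LLL_reduced {m n : nat} (B : 'M[R]_(m, n)) : Prop :=
  [/\ row_free B^T,
      forall i j : 'I_n, (j < i)%N -> `|mu B i j| <= 1 / 2
    & forall i j : 'I_n, i = j.+1 :> nat ->
        enorm (mu B i j *: gso B j + gso B i) ^+ 2
          >= 3 / 4 * enorm (gso B j) ^+ 2].

Definition is_max (S : set R) (M : R) : Prop := S M /\ ubound S M.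
Definition is_min (S : set R) (m : R) : Prop := S m /\ lbound S m.

(* w is the width of Q along c; it is a relation rather than a function
   because the maximum and the minimum need not exist for a general Q. *)
Definition is_width {n : nat} (c : 'rV[R]_n) (Q : set 'cV[R]_n) (w : R) :
    Prop :=
  exists M m : R,
    [/\ is_max [set (c *m lam) 0 0 | lam in Q] M,
        is_min [set (c *m lam) 0 0 | lam in Q] m
      & w = M - m].

Lemma is_width_unique n (c : 'rV[R]_n) (Q : set 'cV[R]_n) (w w' : R) :
  is_width c Q w -> is_width c Q w' -> w = w'.
Proof.
move=> [M [m [[SM uM] [Sm lm] ->]]] [M' [m' [[SM' uM'] [Sm' lm'] ->]]].
have -> : M = M' by apply/le_anti/andP; split; [exact: uM' | exact: uM].
by have -> : m = m' by apply/le_anti/andP; split; [exact: lm | exact: lm'].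
Qed.

Definition Bmx (rho : R) (n : nat) : 'M[R]_n :=
  \matrix_(i < n, j < n)
    (if (i < j)%N then rho ^+ i / 2 else if i == j then rho ^+ j else 0).

Definition Qset {n : nat} (B : 'M[R]_n) : set 'cV[R]_n :=
  [set lam | forall i, 0 <= (B *m lam) i 0 <= (const_mx 1 : 'cV[R]_n) i 0].

End Lattices.

(* Main.v *)
Require Import Defs.
From mathcomp Require Import all_boot all_order all_algebra.
From mathcomp Require Import classical_sets reals.
From mathcomp Require Import ring lra.

Set Implicit Arguments.
Unset Strict Implicit.
Unset Printing Implicit Defensive.

Import Order.TTheory GRing.Theory Num.Theory.
Local Open Scope ring_scope.

(** Everything follows from two features of [Bmx rho n]: it is upper triangular,
    and its diagonal decreases geometrically.

    For an upper triangular matrix with nonzero diagonal, orthogonalizing the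
    columns just erases what lies above the diagonal, so [b_i^*] is the diagonal
    entry times a unit vector ([gso_upper]) and the coefficients [mu] are ratios
    of entries of one row ([mu_upper]).  Here [mu i j = 1/2] for all [j < i], and
    the second LLL condition reduces to [1/4 + rho^2 >= 3/4].

    With 0-based indices the squared lengths satisfy
    [|b_{i+1}|^2 - |b_i|^2 = rho^(2i) (rho^2 - 3/4)], which is positive exactly
    because [rho > sqrt 3 / 2]; hence the last column is the longest
    ([sqlen_ltn]).  Yet all lengths stay below a constant, by summing a geometric
    series ([sqlen_bounded]).

    The last row of a triangular matrix only sees the last coordinate, so on [Q]
    this coordinate ranges over [[0, 1/d]] where [d] is the last diagonal entry;
    invertibility gives a point of [Q] at the upper end ([width_upper]).  For
    [Bmx rho n.+1] the width is thus [rho^-n].  It grows exponentially while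
    [|b_n|] is bounded, so with [c = sqrt (1/rho)] one factor [c^n] of
    [rho^-n = c^n c^n] pays for [c^n] and the other, for large [n], for the
    bounded quantity [c |b_n|]. *)

(** * Euclidean norm *)

Section Norm.
Variable R : realType.

Lemma enorm_ge0 m (v : 'cV[R]_m) : 0 <= enorm v.
Proof. exact: sqrtr_ge0. Qed.

Lemma enorm_sqr m (v : 'cV[R]_m) : enorm v ^+ 2 = \sum_i v i 0 ^+ 2.
Proof. by rewrite sqr_sqrtr // sumr_ge0 // => i _; rewrite sqr_ge0. Qed.

Lemma dot_delta m (v : 'cV[R]_m) (i : 'I_m) a :
  dot v (a *: delta_mx i 0) = a * v i 0.
Proof.
rewrite /dot mxE (bigD1 i) //= big1 => [|k ki].
  by rewrite !mxE !eqxx mulr1 addr0 mulrC.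
by rewrite !mxE (negPf ki) !mulr0.
Qed.

Lemma enorm_delta2 m (i j : 'I_m) (a b : R) : i != j ->
  enorm (a *: delta_mx i 0 + b *: delta_mx j 0) ^+ 2 = a ^+ 2 + b ^+ 2.
Proof.
move=> ij; rewrite enorm_sqr (bigD1 i) //= (bigD1 j) 1?eq_sym //= big1.
  rewrite !mxE !eqxx (negPf ij) eq_sym (negPf ij) /=.
  by rewrite !mulr1 !mulr0 !addr0 add0r.
by move=> k /andP[ki kj]; rewrite !mxE (negPf ki) (negPf kj) !mulr0 addr0 expr0n.
Qed.

Lemma enorm_delta m (i : 'I_m) (a : R) : enorm (a *: delta_mx i 0) ^+ 2 = a ^+ 2.
Proof.
rewrite enorm_sqr (bigD1 i) //= big1 => [|k ki].
  by rewrite !mxE !eqxx mulr1 addr0.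
by rewrite !mxE (negPf ki) mulr0 expr0n.
Qed.

End Norm.

(** * Upper triangular matrices *)

Section UpperTriangular.
Variables (R : realType) (n : nat) (A : 'M[R]_n).
Hypothesis Atrig : is_trig_mx A^T.
Hypothesis Adiag : forall i, A i i != 0.

Lemma upperE (i j : 'I_n) : (j < i)%N -> A i j = 0.
Proof. by move=> ji; have /is_trig_mxP/(_ _ _ ji) := Atrig; rewrite mxE. Qed.

Lemma unitmx_upper : A^T \in unitmx.
Proof.
rewrite unitmxE det_trig // unitfE; apply/prodf_neq0 => i _.
by rewrite mxE.
Qed.

Lemma gs_coef_delta (v : 'cV[R]_n) (i : 'I_n) (a : R) : a != 0 ->
  gs_coef v (a *: delta_mx i 0) = v i 0 / a.
Proof. by move=> a0; rewrite /gs_coef dot_delta enorm_delta; field. Qed.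

(** By induction, the vectors already found span the first coordinate axes, so
    subtracting the projections removes exactly the entries above the
    diagonal. *)
Lemma gso_upper i : gso A i = A i i *: delta_mx i 0.
Proof.
have [k] := ubnP (i : nat); elim: k i => // k IHk i; rewrite ltnS => le_ik.
rewrite gsoE (eq_bigr (fun j => A j i *: delta_mx j 0)); last first.
  move=> j ji; rewrite /mu IHk ?(leq_trans ji) // gs_coef_delta //.
  by rewrite mxE scalerA divfK.
apply/colP=> r; rewrite !mxE summxE andbT.
have [lt_ri|lt_ir|eq_ri] := ltngtP (r : nat) i.
- rewrite (bigD1 r) //= big1 => [|j /andP[_ jr]].
    by rewrite !mxE !eqxx mulr1 addr0 subrr -val_eqE (ltn_eqF lt_ri) mulr0.
  by rewrite !mxE eq_sym (negPf jr) mulr0.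
- rewrite upperE // big1 => [|j ji].
    by rewrite -val_eqE (gtn_eqF lt_ir) subr0 mulr0.
  by rewrite !mxE -val_eqE (gtn_eqF (ltn_trans ji lt_ir)) mulr0.
- move/val_inj: eq_ri => ->; rewrite eqxx mulr1 big1 ?subr0 // => j ji.
  by rewrite !mxE -val_eqE (gtn_eqF ji) mulr0.
Qed.

Lemma mu_upper i j : mu A i j = A j i / A j j.
Proof. by rewrite /mu gso_upper gs_coef_delta // mxE. Qed.

End UpperTriangular.

(** The upper bound comes from the last inequality defining [Q] alone; it is
    attained at [A^-1 e], which solves all the inequalities with equality. *)
Lemma width_upper (R : realType) n (A : 'M[R]_n.+1) :
  is_trig_mx A^T -> (forall i, 0 < A i i) ->
  is_width (delta_mx 0 ord_max : 'rV[R]_n.+1) (Qset A) (A ord_max ord_max)^-1.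
Proof.
move=> Atrig Apos; have Adiag i : A i i != 0 by rewrite gt_eqF.
have Aunit : A \in unitmx by rewrite -unitmx_tr unitmx_upper.
have valE (lam : 'cV[R]_n.+1) : (delta_mx 0 ord_max *m lam : 'M_1) 0 0 =
    (A *m lam) ord_max 0 / A ord_max ord_max.
  rewrite -rowE !mxE (bigD1 ord_max) //= big1 ?addr0 1?mulrC ?mulKf // => k kmax.
  rewrite upperE ?mul0r // ltn_neqAle -ltnS ltn_ord andbT.
  by rewrite (inj_eq val_inj).
exists (A ord_max ord_max)^-1, 0; rewrite subr0; split => //; split.
- exists (invmx A *m const_mx 1).
    move=> i; rewrite mulmxA mulmxV // mul1mx.
    by rewrite mxE ler01 lexx.
  by rewrite valE mulmxA mulmxV // mul1mx mxE mul1r.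
- move=> _ [lam Qlam <-]; rewrite valE ler_pdivrMr // mulVf //.
  by have /andP[_] := Qlam ord_max; rewrite [const_mx _ _ _]mxE.
- exists 0; last by rewrite valE mulmx0 mxE mul0r.
  by move=> i; rewrite mulmx0 !mxE lexx ler01.
- move=> _ [lam Qlam <-]; rewrite valE divr_ge0 ?(ltW (Apos _)) //.
  by have /andP[] := Qlam ord_max.
Qed.

(** * Geometry of the columns *)

Section Columns.
Variables (R : realType) (rho : R).
Hypothesis rho_gt0 : 0 < rho.

Lemma Bmx_diag n (i : 'I_n) : Bmx rho n i i = rho ^+ i.
Proof. by rewrite mxE ltnn eqxx. Qed.

Lemma Bmx_above n (i j : 'I_n) : (i < j)%N -> Bmx rho n i j = rho ^+ i / 2.
Proof. by move=> ij; rewrite mxE ij. Qed.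

Lemma Bmx_trig n : is_trig_mx (Bmx rho n)^T.
Proof.
apply/is_trig_mxP => i j ij; rewrite !mxE ltnNge ltnW //=.
by rewrite -val_eqE (gtn_eqF ij).
Qed.

Lemma Bmx_diag_gt0 n (i : 'I_n) : 0 < Bmx rho n i i.
Proof. by rewrite Bmx_diag exprn_gt0. Qed.

Lemma Bmx_diag_neq0 n (i : 'I_n) : Bmx rho n i i != 0.
Proof. by rewrite gt_eqF ?Bmx_diag_gt0. Qed.

(** The squared length of the column of index [i], which does not depend on the
    size of the matrix. *)
Definition sqlen (i : nat) : R :=
  (\sum_(k < i) (rho ^+ 2) ^+ k) / 4 + (rho ^+ 2) ^+ i.

Lemma enorm_col n (i : 'I_n) : enorm (col i (Bmx rho n)) ^+ 2 = sqlen i.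
Proof.
rewrite enorm_sqr /sqlen (bigID (fun k : 'I_n => (k < i)%N)) /=; congr (_ + _).
  rewrite mulr_suml (big_ord_widen n (fun k => (rho ^+ 2) ^+ k / 4)) 1?ltnW //.
  by apply: eq_bigr => k ki; rewrite mxE Bmx_above // exprAC; field.
rewrite (bigD1 i) ?ltnn //= big1 ?addr0 => [|k /andP[]].
  by rewrite mxE Bmx_diag exprAC.
by rewrite !mxE => /negPf -> /negPf ->; rewrite expr0n.
Qed.

Lemma sqlen_ltn : 3 / 4 < rho ^+ 2 -> {homo sqlen : i j / (i < j)%N >-> i < j}.
Proof.
move=> rho2; apply: homo_ltn; first exact: lt_trans.
move=> i; rewrite /sqlen big_ord_recr /= [_ ^+ i.+1]exprS -subr_gt0.
set s := \sum_(_ < _) _; set p := _ ^+ i.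
have -> : (s + p) / 4 + rho ^+ 2 * p - (s / 4 + p) = p * (rho ^+ 2 - 3 / 4).
  by field.
by rewrite mulr_gt0 ?subr_gt0 // !exprn_gt0.
Qed.

Lemma sqlen_bounded i : rho < 1 -> sqlen i <= (1 - rho ^+ 2)^-1 + 1.
Proof.
move=> rho1; have r2 : rho ^+ 2 < 1 by rewrite exprn_ilt1 ?ltW.
have r2_ge0 : 0 <= rho ^+ 2 by rewrite sqr_ge0.
have s_ge0 : 0 <= \sum_(k < i) (rho ^+ 2) ^+ k.
  by apply: sumr_ge0 => k _; rewrite exprn_ge0.
have s_le : \sum_(k < i) (rho ^+ 2) ^+ k <= (1 - rho ^+ 2)^-1.
  rewrite -div1r ler_pdivlMr ?subr_gt0 // mulrC -opprB mulNr -subrX1 opprB.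
  by rewrite lerBlDr lerDl exprn_ge0.
by rewrite lerD //; [lra | rewrite exprn_ile1 // ltW].
Qed.

Lemma Bmx_LLL n : 1 / 2 <= rho ^+ 2 -> LLL_reduced (Bmx rho n).
Proof.
move=> rho2; split.
- by rewrite row_free_unit unitmx_upper ?Bmx_trig //; apply: Bmx_diag_neq0.
- move=> i j ji; rewrite mu_upper ?Bmx_trig //; last exact: Bmx_diag_neq0.
  rewrite Bmx_diag Bmx_above // mulrAC mulfV ?expf_neq0 ?gt_eqF //.
  by rewrite ger0_norm // divr_ge0.
- move=> i j ij; have ji : (j < i)%N by rewrite ij.
  rewrite mu_upper ?Bmx_trig //; last exact: Bmx_diag_neq0.
  rewrite !gso_upper ?Bmx_trig //; try exact: Bmx_diag_neq0.
  rewrite scalerA divfK ?Bmx_diag_neq0 //.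
  rewrite enorm_delta2; last by rewrite -val_eqE (ltn_eqF ji).
  rewrite enorm_delta !Bmx_diag Bmx_above // ij [_ ^+ j.+1]exprS.
  rewrite -subr_ge0; set p := rho ^+ j.
  have -> : (p / 2) ^+ 2 + (rho * p) ^+ 2 - 3 / 4 * p ^+ 2 =
            p ^+ 2 * (rho ^+ 2 - 1 / 2) by field.
  by rewrite mulr_ge0 ?sqr_ge0 ?subr_ge0.
Qed.

End Columns.

(** * Growth *)

(** Bernoulli's inequality and the archimedean property. *)
Lemma expr_unbounded (R : archiRealFieldType) (c K : R) : 1 < c ->
  exists N : nat, forall n : nat, (N <= n)%N -> K < c ^+ n.
Proof.
move=> c1; have d0 : 0 < c - 1 by rewrite subr_gt0.
exists (Num.bound (`|K| / (c - 1))) => n leNn.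
have lt_Kn : `|K| / (c - 1) < n%:R.
  apply: (lt_le_trans (archi_boundP _)); first by rewrite divr_ge0 // ltW.
  by rewrite ler_nat.
rewrite ltr_pdivrMr // in lt_Kn.
apply: (le_lt_trans (ler_norm K)); apply: (lt_le_trans lt_Kn).
elim: n {leNn lt_Kn} => [|n IHn]; first by rewrite mul0r.
rewrite exprS -natr1 mulrDl mul1r -[leRHS](subrK (c ^+ n)) addrC.
rewrite lerD // -[X in _ <= _ - X]mul1r -mulrBl ler_peMr ?(ltW d0) //.
by rewrite exprn_ege1 // ltW.
Qed.

Theorem proposition1 (R : realType) (rho : R)
    (hrho : Num.sqrt 3 / 2 < rho < 1) :
  (forall n : nat,
     let B := Bmx rho n.+1 in
     (lattice_basis B (lattice B) /\ LLL_reduced B) /\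
     (forall i : 'I_n.+1, i != ord_max ->
        enorm (col i B) < enorm (col ord_max B))) /\
  (exists c : R, 1 < c /\
     exists N : nat, forall n : nat, (N <= n.+1)%N ->
       let B := Bmx rho n.+1 in
       exists w : R,
         is_width (delta_mx 0 ord_max : 'rV[R]_n.+1) (Qset B) w /\
         w > c ^+ n.+1 * enorm (col ord_max B)).
Proof.
have /andP[rho_gt rho_lt1] := hrho.
have rho_gt0 : 0 < rho by apply: le_lt_trans rho_gt; rewrite divr_ge0 ?sqrtr_ge0.
have rho2 : 3 / 4 < rho ^+ 2.
  have -> : 3 / 4 = (Num.sqrt 3 / 2) ^+ 2 :> R.
    by rewrite expr_div_n sqr_sqrtr //; field.
  by rewrite ltr_pXn2r // nnegrE ?divr_ge0 ?sqrtr_ge0 ?ltW.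
split=> [n B|].
  have BLLL : LLL_reduced B by apply: Bmx_LLL => //; lra.
  split; first by split; first split; case: BLLL.
  move=> i imax; rewrite -(ltr_pXn2r (ltn0Sn 1)) ?nnegrE ?enorm_ge0 //.
  rewrite !enorm_col; apply: sqlen_ltn => //.
  by rewrite ltn_neqAle (inj_eq val_inj) imax -ltnS ltn_ord.
pose c := Num.sqrt rho^-1.
have c1 : 1 < c by rewrite -sqrtr1 ltr_sqrt ?invr_gt0 // invf_gt1.
have c_gt0 : 0 < c by apply: lt_trans c1.
pose K := (1 - rho ^+ 2)^-1 + 1.
have enormK n (i : 'I_n) : enorm (col i (Bmx rho n)) <= Num.sqrt K.
  rewrite -[leLHS]ger0_norm ?enorm_ge0 // -sqrtr_sqr ler_wsqrtr //.
  by rewrite enorm_col sqlen_bounded.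
have [N cN] := expr_unbounded (c * Num.sqrt K) c1.
(* The threshold is for the size of the matrix, whose last index is one less. *)
exists c; split=> //; exists N.+1 => n leNn B; exists (B ord_max ord_max)^-1.
split; first by apply: width_upper; [exact: Bmx_trig | exact: Bmx_diag_gt0].
rewrite Bmx_diag -exprVn /= -[rho^-1]sqr_sqrtr ?invr_ge0 ?ltW // -/c.
rewrite exprAC expr2 exprSr -mulrA ltr_pM2l ?exprn_gt0 //.
by apply: le_lt_trans (cN n leNn); rewrite ler_pM2l.
Qed.
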